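(* Let $\ell\ge3$ and let $\tau=\tau_1\tau_2\cdots\tau_\ell\text{-}\tau_{\ell+1}$ be a vincular pattern of length $\ell+1$ such that $\tau_1\le\tau_2\le\cdots\le\tau_{j-1}<\tau_j>\tau_{j+1}\ge\tau_{j+2}\ge\cdots\ge\tau_\ell$ for some $2\le j\le\ell-1$, and $\tau_j<\tau_{\ell+1}$. Let $\rho=\rho_1\cdots\rho_\ell\text{-}\rho_{\ell+1}$ be the vincular pattern obtained from $\tau$ by interchanging the letters $\tau_j$ and $\tau_{\ell+1}$ (keeping the dash in the same place). Then $\tau\sim\rho$, and moreover $a_\tau(n,k;a)=a_\rho(n,k;a)$ for all $n\ge1$, $k\ge1$ and $a\in[k]$.
   Context: For $k\ge1$ let $[k]=\{1,\dots,k\}$; a $k$-ary word of length $n$ is an element of $[k]^n$. A pattern is a word $\sigma=\sigma_1\cdots\sigma_m\in[p]^m$ in which every letter of $[p]$ occurs. Two words are order-isomorphic if replacing the $i$-th smallest distinct letter by $i$ yields the same word. A vincular pattern is a pattern with dashes inserted between some consecutive letters; a word $w=w_1\cdots w_n$ contains it if there are indices $i_1<\dots<i_m$ with $w_{i_1}\cdots w_{i_m}$ order-isomorphic to the underlying pattern and $i_{r+1}=i_r+1$ whenever the $r$-th and $(r+1)$-st letters of the pattern are not separated by a dash; otherwise $w$ avoids it. Thus $\tau_1\cdots\tau_\ell\text{-}\tau_{\ell+1}$ requires the first $\ell$ letters of an occurrence to be consecutive in $w$. $a_\sigma(n,k)$ is the number of words in $[k]^n$ avoiding $\sigma$, and $a_\sigma(n,k;a)$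 the number of those whose first letter is $a$. $\sigma\sim\tau$ (Wilf-equivalence) means $a_\sigma(n,k)=a_\tau(n,k)$ for all $n\ge0,k\ge1$. *)

(* Defs.v *)
From mathcomp Require Import all_boot.

Set Implicit Arguments.
Unset Strict Implicit.
Unset Printing Implicit Defensive.

(* Positions in words and patterns are 1-based. *)
Definition letter (s : seq nat) (i : nat) : nat := nth 0 s i.-1.

Definition is_pattern (s : seq nat) : Prop :=
  exists p : nat, forall x : nat, (x \in s) = (1 <= x <= p).

(* Replaces the i-th smallest distinct letter of s by i: the rank of x is the
   number of distinct letters of s that are at most x. *)
Definition standardize (s : seq nat) : seq nat :=
  [seq size (undup [seq y <- s | y <= x]) | x <- s].

Definition order_isomorphic (s t : seq nat) : bool :=
  standardize s == standardize t.

(* r \in vdashes: a dash separates the r-th and (r+1)-st letters. *)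
Record vincular := Vincular { vword : seq nat; vdashes : seq nat }.

(* A k-ary word is an n.-tuple 'I_k, the letter a of [k] = {1, ..., k} being
   encoded by a - 1; order-isomorphism is insensitive to this shift. *)
Definition occurrence (sigma : vincular) (n k : nat) (w : n.-tuple 'I_k)
    (idx : (size (vword sigma)).-tuple 'I_n) : bool :=
  let pos := [seq val i | i <- idx] in
  [&& sorted ltn pos,
      order_isomorphic [seq val (tnth w i) | i <- idx] (vword sigma) &
      all (fun r => (r \in vdashes sigma)
                    || (letter pos r.+1 == (letter pos r).+1))
          (iota 1 (size (vword sigma)).-1)].

Definition contains (sigma : vincular) (n k : nat) (w : n.-tuple 'I_k) : bool :=
  [exists idx : (size (vword sigma)).-tuple 'I_n, occurrence w idx].

Definition avoids (sigma : vincular) (n k : nat) (w : n.-tuple 'I_k) : bool :=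
  ~~ contains sigma w.

Definition num_avoid (sigma : vincular) (n k : nat) : nat :=
  #|[set w : n.-tuple 'I_k | avoids sigma w]|.

Definition num_avoid_first (sigma : vincular) (n k : nat) (a : 'I_k) : nat :=
  #|[set w : n.-tuple 'I_k | avoids sigma w & ohead w == Some a]|.

Definition wilf_equivalent (sigma tau : vincular) : Prop :=
  forall n k : nat, 1 <= k -> num_avoid sigma n k = num_avoid tau n k.

Definition swap_letters (s : seq nat) (i j : nat) : seq nat :=
  set_nth 0 (set_nth 0 s i.-1 (letter s j)) j.-1 (letter s i).

(* Main.v *)
(** Let [q = j - 1], and call a letter a peak if it plays the role of [tau_j] in
    a consecutive occurrence of [tau_1 ... tau_l].  Because the pattern is
    unimodal with a strict maximum, no peak lies in the window of another one,
    and a peak may be given any value above the larger of its two neighbours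
    without creating or destroying occurrences.  Write [w = u x v] where [x] is
    the first peak, and let [m < x] be the larger neighbour of [x].  Then [w]
    avoids [tau] iff all letters of [v] are at most [x] and [v] avoids [tau],
    and [w] avoids [rho] iff [v] has no letter strictly between [m] and [x] and
    [v] avoids [rho].  With letters [0, ..., k - 1], sending [x] to
    [k + m - x], transforming [v] recursively over the alphabet of size [x + 1]
    and then shifting its letters above [m] up by [k - 1 - x] is a bijection
    between the two classes.  It fixes everything before the first peak, in
    particular the first letter. *)
Require Import Defs.
From mathcomp Require Import all_boot zify.

Set Implicit Arguments.
Unset Strict Implicit.
Unset Printing Implicit Defensive.

(** * Consecutive occurrences of a unimodal pattern and the letters at their peaks *)

Section ConsecutivePeak.

Variables (s : seq nat) (q l : nat).

Hypothesis q_gt0 : 0 < q.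
Hypothesis q_lt : q.+1 < l.
Hypothesis s_up : forall a, a < q -> nth 0 s a <= nth 0 s a.+1.
Hypothesis s_down : forall a, q <= a -> a.+1 < l -> nth 0 s a.+1 <= nth 0 s a.
Hypothesis s_left : nth 0 s q.-1 < nth 0 s q.
Hypothesis s_right : nth 0 s q.+1 < nth 0 s q.

Lemma pattern_le_left a : a < q -> nth 0 s a <= nth 0 s q.-1.
Proof.
move=> ltaq; have [d] : exists d, d + a = q.-1 by exists (q.-1 - a); lia.
elim: d a ltaq => [|d IHd] a ltaq ad; first by rewrite -ad.
by apply: leq_trans (s_up ltaq) _; apply: IHd; lia.
Qed.

Lemma pattern_le_right a : q < a < l -> nth 0 s a <= nth 0 s q.+1.
Proof.
elim: a => [|a IHa]; first by lia.
case/andP=> qa al; have [->//|neq_qa] := eqVneq q a.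
by apply: leq_trans (s_down _ al) (IHa _); lia.
Qed.

Lemma pattern_lt_peak a : a < l -> a != q -> nth 0 s a < nth 0 s q.
Proof.
move=> al aq; have [lt_aq|lt_qa|eq_aq] := ltngtP a q; last by lia.
  by apply: leq_ltn_trans (pattern_le_left lt_aq) s_left.
by apply: leq_ltn_trans (pattern_le_right _) s_right; rewrite lt_qa.
Qed.

(** Order isomorphism is expressed by pairwise comparisons. Only the first [l] letters of [s] are
    inspected, so [s] may be the whole pattern, including its letter after the dash. *)
Definition occurs_at (w : seq nat) (i : nat) : bool :=
  (i + l <= size w) &&
  [forall a : 'I_l, forall b : 'I_l,
     (nth 0 w (i + a) <= nth 0 w (i + b)) == (nth 0 s a <= nth 0 s b)].

Lemma occurs_atP w i :
  reflect (i + l <= size w /\ forall a b, a < l -> b < l ->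
             (nth 0 w (i + a) <= nth 0 w (i + b)) = (nth 0 s a <= nth 0 s b))
          (occurs_at w i).
Proof.
apply: (iffP andP) => [[szw /forallP occ]|[szw occ]]; split=> //.
  by move=> a b al bl; have /forallP/(_ (Ordinal bl))/eqP := occ (Ordinal al).
by apply/forallP => a; apply/forallP => b; apply/eqP; apply: occ.
Qed.

Lemma eq_occurs_at w w' i : i + l <= size w' ->
    (forall a, a < l -> nth 0 w' (i + a) = nth 0 w (i + a)) ->
  occurs_at w i -> occurs_at w' i.
Proof.
move=> szw' eqw /occurs_atP[_ occ]; apply/occurs_atP; split=> // a b al bl.
by rewrite !eqw ?occ.
Qed.

Lemma occurs_at_le w i a b : occurs_at w i -> a < l -> b < l ->
  nth 0 s a <= nth 0 s b -> nth 0 w (i + a) <= nth 0 w (i + b).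
Proof. by case/occurs_atP=> _ occ al bl; rewrite occ. Qed.

Lemma occurs_at_lt w i a b : occurs_at w i -> a < l -> b < l ->
  nth 0 s a < nth 0 s b -> nth 0 w (i + a) < nth 0 w (i + b).
Proof. by case/occurs_atP=> _ occ al bl; rewrite !ltnNge occ. Qed.

Lemma occurs_at_map f w i : {mono f : x y / x <= y} ->
  occurs_at (map f w) i = occurs_at w i.
Proof.
move=> fmono; apply/occurs_atP/occurs_atP; rewrite size_map => -[szw occ];
  split=> // a b al bl; rewrite -occ // !(nth_map 0) ?fmono //; lia.
Qed.

(* Avoidance of [tau] ([avoids_above]) and of [rho] ([avoids_between]).  Here
   [z] ranges over all positions after the peak, not only those after the
   window: letters of the window never violate either condition. *)
Definition avoids_above (w : seq nat) : Prop :=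
  forall i z, occurs_at w i -> i + q < z < size w ->
    nth 0 w z <= nth 0 w (i + q).

Definition avoids_between (w : seq nat) : Prop :=
  forall i z, occurs_at w i -> i + q < z < size w ->
    maxn (nth 0 w (i + q).-1) (nth 0 w (i + q).+1) < nth 0 w z ->
    nth 0 w (i + q) <= nth 0 w z.

Lemma avoids_between_map f w : {mono f : x y / x <= y} ->
  avoids_between (map f w) <-> avoids_between w.
Proof.
move=> fmono; have fltn := leqW_mono fmono.
split=> av i z occ ltz; rewrite gtn_max.
  have := av i z; rewrite occurs_at_map // size_map => /(_ occ ltz).
  case/occurs_atP: occ => szw _.
  by rewrite gtn_max !(nth_map 0) ?fmono ?fltn; try lia; apply.
move: occ ltz; rewrite occurs_at_map // size_map => occ ltz.
have := av i z occ ltz; case/occurs_atP: occ => szw _.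
by rewrite gtn_max !(nth_map 0) ?fmono ?fltn; try lia; apply.
Qed.

(** * Factorisation of a word at its first peak *)

Definition first_peak (i : nat) (u : seq nat) (x : nat) (v : seq nat) : Prop :=
  [/\ size u = i + q, occurs_at (u ++ x :: v) i &
      forall i', occurs_at (u ++ x :: v) i' -> i <= i'].

(** This is the [m] of the overview. At a peak both [u] and [v] are nonempty, because [0 < q] and
    [q.+1 < l], so the default 0 is never read there. *)
Definition shoulder (u v : seq nat) : nat := maxn (last 0 u) (head 0 v).

Lemma nth_peak u x v : nth 0 (u ++ x :: v) (size u) = x.
Proof. by rewrite nth_cat ltnn subnn. Qed.

Lemma nth_before u x v a : a < size u -> nth 0 (u ++ x :: v) a = nth 0 u a.
Proof. by move=> au; rewrite nth_cat au. Qed.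

Lemma nth_after u x v a : nth 0 (u ++ x :: v) ((size u).+1 + a) = nth 0 v a.
Proof. by rewrite addSn nth_cat ltnNge leqW ?leq_addr //= subSn ?leq_addr // addKn. Qed.

Section FirstPeak.

Variables (i x : nat) (u v : seq nat).
Hypothesis fp : first_peak i u x v.

Let sz_u : size u = i + q. Proof. by case: fp. Qed.
Let occ_i : occurs_at (u ++ x :: v) i. Proof. by case: fp. Qed.
Let first_i i' : occurs_at (u ++ x :: v) i' -> i <= i'.
Proof. by case: fp => _ _; apply. Qed.

Lemma first_peak_size : l - q.+1 <= size v.
Proof.
by case/occurs_atP: occ_i; rewrite size_cat /=; lia.
Qed.

Lemma first_peak_last : last 0 u = nth 0 (u ++ x :: v) (i + q.-1).
Proof. by rewrite nth_before -?nth_last; [congr nth; lia | lia]. Qed.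

Lemma first_peak_head : head 0 v = nth 0 (u ++ x :: v) (i + q.+1).
Proof. by rewrite addnS -sz_u -[_.+1]addn0 nth_after nth0. Qed.

Lemma first_peak_nth : nth 0 (u ++ x :: v) (i + q) = x.
Proof. by rewrite -sz_u nth_peak. Qed.

Lemma first_peak_lt : shoulder u v < x.
Proof.
rewrite -[X in _ < X]first_peak_nth gtn_max first_peak_last first_peak_head.
by rewrite !(occurs_at_lt occ_i) //; lia.
Qed.

(** The window rises weakly up to its peak and falls weakly after it, so on each side the letter
    next to the peak is the largest. *)
Lemma first_peak_window a : a < l -> a != q ->
  nth 0 (u ++ x :: v) (i + a) <= shoulder u v.
Proof.
move=> al aq; rewrite leq_max first_peak_last first_peak_head.
have [aq'|qa|] := ltngtP a q; last by lia.
  by rewrite (occurs_at_le occ_i) ?pattern_le_left //; lia.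
by rewrite orbC (occurs_at_le occ_i) ?pattern_le_right //; lia.
Qed.

Lemma first_peak_tail y : y \in take (l - q.+1) v -> y <= shoulder u v.
Proof.
case/(nthP 0)=> b; rewrite size_take_min => ltb <-.
have := @first_peak_window (q.+1 + b).
rewrite addnA addnS -sz_u nth_after nth_take; last by lia.
by apply; lia.
Qed.

(* Peaks are strict, so none lies in the window of another one. *)
Lemma first_peak_tail_occ i' : occurs_at v i' -> l - q.+1 <= i' + q.
Proof.
move=> occ; rewrite leqNgt; apply/negP => lt.
have lt1 : nth 0 v (i' + q.-1) < nth 0 v (i' + q).
  by apply: occurs_at_lt occ _ _ s_left; lia.
(* These two neighbouring letters of [v] also lie on the descending side of the window at [i], so
   they cannot form a strict ascent. *)
suff: nth 0 v (i' + q) <= nth 0 v (i' + q.-1) by rewrite leqNgt lt1.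
have eqn b : nth 0 v b = nth 0 (u ++ x :: v) (i + (q.+1 + b)).
  by rewrite -(nth_after u x); congr nth; lia.
rewrite !eqn; apply: occurs_at_le occ_i _ _ _; try lia.
have -> : q.+1 + (i' + q) = (q.+1 + (i' + q.-1)).+1 by lia.
by apply: s_down; lia.
Qed.

(** This lets both avoidance conditions split into a condition on [x] and the same condition on [v]:
    no later window can start at or before the position of [x]. *)
Lemma first_peak_occ i' :
  occurs_at (u ++ x :: v) i' ->
  i' = i \/ exists2 b, i' = (size u).+1 + b & occurs_at v b.
Proof.
move=> occ; have := first_i occ; rewrite leq_eqVlt => /orP[/eqP->|lt]; first by left.
right; have [le|lt'] := leqP (size u).+1 i'.
  exists (i' - (size u).+1); first by lia.
  case/occurs_atP: occ; rewrite size_cat /= => sz occ.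
  apply/occurs_atP; split; first by lia.
  have eqn c : nth 0 v (i' - (size u).+1 + c) = nth 0 (u ++ x :: v) (i' + c).
    by rewrite -(nth_after u x) addnA subnKC.
  by move=> a b al bl; rewrite -occ // !eqn.
(* If [i < i' <= i + q], then [x] sits at an offset below [q] in the window at [i'], on its
   ascending side. Hence [x] is at most the next letter, against the strictness of the peak. *)
have := @occurs_at_le _ i' (i + q - i') (i + q - i').+1 occ.
rewrite !addnS subnKC; last by lia.
have -> : (i + q).+1 = i + q.+1 by lia.
rewrite first_peak_nth -first_peak_head => H.
have := first_peak_lt; rewrite gtn_max => /andP[_]; rewrite ltnNge H //; try lia.
by apply: s_up; lia.
Qed.

Lemma tail_occ b : occurs_at v b -> occurs_at (u ++ x :: v) ((size u).+1 + b).
Proof.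
case/occurs_atP=> sz occ; apply/occurs_atP; rewrite size_cat /=; split; first by lia.
by move=> a c al cl; rewrite -!addnA !nth_after occ.
Qed.

Lemma avoids_above_peak :
  avoids_above (u ++ x :: v) <-> all (fun y => y <= x) v /\ avoids_above v.
Proof.
split=> [av|[/allP vx av] i' z].
  split.
    apply/(all_nthP 0) => b bv.
    have := av i ((size u).+1 + b) occ_i.
    by rewrite nth_after first_peak_nth; apply; rewrite size_cat /=; lia.
  move=> i' z occ ltz.
  have := av _ ((size u).+1 + z) (tail_occ occ).
  by rewrite -!addnA !nth_after; apply; rewrite size_cat /=; lia.
case/first_peak_occ=> [->|[b -> occ]]; rewrite size_cat /= => ltz;
  have ltzv : z - (size u).+1 < size v by lia.
  rewrite first_peak_nth; apply: vx.
  have -> : z = (size u).+1 + (z - (size u).+1) by lia.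
  by rewrite nth_after mem_nth.
have -> : z = (size u).+1 + (z - (size u).+1) by lia.
by rewrite -!addnA !nth_after; apply: av => //; lia.
Qed.

Lemma avoids_between_peak :
  avoids_between (u ++ x :: v) <->
  all (fun y => (shoulder u v < y) ==> (x <= y)) v /\ avoids_between v.
Proof.
have eqs : maxn (nth 0 (u ++ x :: v) (i + q).-1) (nth 0 (u ++ x :: v) (i + q).+1)
         = shoulder u v.
  by rewrite /shoulder first_peak_last first_peak_head; congr (maxn (nth _ _ _) (nth _ _ _)); lia.
have eqt b : maxn (nth 0 (u ++ x :: v) ((size u).+1 + b + q).-1)
                  (nth 0 (u ++ x :: v) ((size u).+1 + b + q).+1)
         = maxn (nth 0 v (b + q).-1) (nth 0 v (b + q).+1).
  by rewrite -!(nth_after u x v); congr (maxn (nth _ _ _) (nth _ _ _)); lia.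
split=> [av|[/allP vx av] i' z].
  split.
    apply/(all_nthP 0) => b bv; apply/implyP.
    have := av i ((size u).+1 + b) occ_i.
    by rewrite eqs nth_after first_peak_nth; apply; rewrite size_cat /=; lia.
  move=> i' z occ ltz.
  have := av _ ((size u).+1 + z) (tail_occ occ).
  by rewrite eqt -!addnA !nth_after; apply; rewrite size_cat /=; lia.
case/first_peak_occ=> [->|[b -> occ]]; rewrite size_cat /= => ltz;
  have ltzv : z - (size u).+1 < size v by lia.
  rewrite eqs first_peak_nth.
  have -> : z = (size u).+1 + (z - (size u).+1) by lia.
  by rewrite nth_after => lt; move/implyP: (vx _ (mem_nth 0 ltzv)); apply.
have -> : z = (size u).+1 + (z - (size u).+1) by lia.
by rewrite eqt -!addnA !nth_after; apply: av => //; lia.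
Qed.

(** Of [v], only the first [l - q.+1] letters belong to the window of the peak. With these kept, any
    value above the shoulder still gives an occurrence at [i], and no earlier one can appear. *)
Lemma first_peak_change x' v' :
    shoulder u v < x' -> take (l - q.+1) v' = take (l - q.+1) v ->
  first_peak i u x' v' /\ shoulder u v' = shoulder u v.
Proof.
move=> ltx' eqv.
have szv' : l - q.+1 <= size v'.
  by have := congr1 size eqv; have := first_peak_size; rewrite !size_take_min; lia.
have eqn a : i + a < size u + (l - q) -> i + a != size u ->
    nth 0 (u ++ x' :: v') (i + a) = nth 0 (u ++ x :: v) (i + a).
  move=> lta neqa; have [lt|lt|] := ltngtP (i + a) (size u); last by lia.
    by rewrite !nth_before.
  have -> : i + a = (size u).+1 + (i + a - (size u).+1) by lia.
  have lt' : i + a - (size u).+1 < l - q.+1 by lia.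
  by rewrite !nth_after -(nth_take 0 lt' v') eqv nth_take.
have eqsh : shoulder u v' = shoulder u v.
  have lr : 0 < l - q.+1 by lia.
  by rewrite /shoulder -!nth0 -(nth_take 0 lr v') eqv nth_take.
split=> //; split=> //.
  apply/occurs_atP; split; first by rewrite size_cat /=; lia.
  have lem c : c < l -> c != q -> nth 0 (u ++ x' :: v') (i + c) <= shoulder u v.
    by move=> cl cq; rewrite eqn ?first_peak_window //; lia.
  have eq' : nth 0 (u ++ x' :: v') (i + q) = x' by rewrite -sz_u nth_peak.
  move=> a b al bl; have [->|aq] := eqVneq a q; have [->|bq] := eqVneq b q.
  - by rewrite !leqnn.
  - have := lem _ bl bq; have := pattern_lt_peak bl bq; rewrite eq'; lia.
  - have := lem _ al aq; have := pattern_lt_peak al aq; rewrite eq'; lia.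
  by case/occurs_atP: occ_i => _ <- //; rewrite !eqn //; lia.
move=> i' occ; rewrite leqNgt; apply/negP => lti.
(* An earlier window either lies inside [u], where nothing has changed, or covers [x'] at an offset
   above [q]. On that descending side [x'] would be at most the letter before it, which is at most
   the shoulder. *)
have [le|lt] := leqP (i' + l) (size u).
  suff /first_i: occurs_at (u ++ x :: v) i' by lia.
  apply: eq_occurs_at occ; first by rewrite size_cat; lia.
  by move=> a al; rewrite !nth_before //; lia.
have := @occurs_at_le _ i' (i + q - i') (i + q - i').-1 occ.
have -> : i' + (i + q - i').-1 = i + q.-1 by lia.
rewrite subnKC; last by lia.
rewrite -sz_u nth_peak eqn -?first_peak_last; try lia.
rewrite sz_u => H; have := ltx'; rewrite gtn_max => /andP[+ _].
rewrite ltnNge H //; try lia.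
have -> : i + q - i' = (i + q - i').-1.+1 by lia.
by apply: s_down; lia.
Qed.

End FirstPeak.

(** * Computing the first peak *)

Definition first_occ (w : seq nat) : nat := find (occurs_at w) (iota 0 (size w)).

Lemma first_occ_peak i u x v : first_peak i u x v ->
  first_occ (u ++ x :: v) = i.
Proof.
case=> szu occ first; have ltsz : i < size (u ++ x :: v).
  by rewrite size_cat /= szu; lia.
have has_occ : has (occurs_at (u ++ x :: v)) (iota 0 (size (u ++ x :: v))).
  by apply/hasP; exists i; rewrite ?mem_iota.
apply/eqP; rewrite eqn_leq; apply/andP; split.
  rewrite leqNgt; apply/negP => /(before_find 0).
  by rewrite nth_iota // add0n occ.
apply: first; have := nth_find 0 has_occ.
by rewrite nth_iota ?add0n // -[X in _ < X](size_iota 0) -has_find.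
Qed.

Variant first_occ_spec (w : seq nat) : seq nat -> Prop :=
  | NoPeak of (forall i, ~~ occurs_at w i) & first_occ w = size w :
      first_occ_spec w w
  | Peak i u x v of first_peak i u x v : first_occ_spec w (u ++ x :: v).

Lemma first_occP w : first_occ_spec w w.
Proof.
have [has_occ|no_occ] := boolP (has (occurs_at w) (iota 0 (size w))).
  have ltsz : first_occ w < size w by rewrite -[X in _ < X](size_iota 0) -has_find.
  have := nth_find 0 has_occ; rewrite -/(first_occ w) nth_iota // add0n => occ.
  have [sz _] := occurs_atP _ _ occ.
  have szq : first_occ w + q < size w by lia.
  have eqw := cat_take_drop (first_occ w + q) w.
  rewrite (drop_nth 0 szq) in eqw.
  rewrite -{2}eqw; apply: (@Peak _ (first_occ w)); split; rewrite ?eqw //.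
    by rewrite size_takel // ltnW.
  move=> i' occ'; rewrite leqNgt; apply/negP => /[dup] lt /(before_find 0).
  by rewrite nth_iota ?add0n ?occ' //; lia.
apply: NoPeak; last by rewrite /first_occ hasNfind // size_iota.
move=> i; apply/negP => occ; case/negP: no_occ; apply/hasP; exists i => //.
by case/occurs_atP: occ; rewrite mem_iota; lia.
Qed.

(** * The two mutually inverse transformations of words *)

Definition expand (m d y : nat) : nat := if y <= m then y else y + d.
Definition contract (m d y : nat) : nat := if y <= m then y else y - d.

Lemma expand_mono m d : {mono expand m d : y z / y <= z}.
Proof. by move=> y z; rewrite /expand; case: (leqP y m); case: (leqP z m); lia. Qed.

Lemma expandK m d : cancel (expand m d) (contract m d).
Proof. by move=> y; rewrite /expand /contract; case: (leqP y m) => ym; case: ifP; lia. Qed.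

(** The values missed by [expand m d] are those from [m + 1] to [m + d], and the hypothesis excludes
    exactly these. *)
Lemma contractK m d y : (m < y) ==> (m + d < y) -> expand m d (contract m d y) = y.
Proof. by rewrite /expand /contract; case: (leqP y m) => /= ym; case: ifP; lia. Qed.

(* The bound [n] on the size only makes the recursion structural. *)
Fixpoint raise_peaks (n k : nat) (w : seq nat) : seq nat :=
  if n is n'.+1 then
    if first_occ w < size w then
      let c := first_occ w + q in
      let: (u, x, v) := (take c w, nth 0 w c, drop c.+1 w) in
      let m := shoulder u v in
      u ++ (k + m - x) :: map (expand m (k - x.+1)) (raise_peaks n' x.+1 v)
    else w
  else w.

(** The steps of [raise_peaks] are undone in reverse order: the original peak [x] is recovered
    first, since it determines both the shift and the smaller alphabet, and [v] is contracted before
    the recursive call. *)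
Fixpoint lower_peaks (n k : nat) (w : seq nat) : seq nat :=
  if n is n'.+1 then
    if first_occ w < size w then
      let c := first_occ w + q in
      let: (u, x', v) := (take c w, nth 0 w c, drop c.+1 w) in
      let m := shoulder u v in
      let x := k + m - x' in
      u ++ x :: lower_peaks n' x.+1 (map (contract m (k - x.+1)) v)
    else w
  else w.

Lemma split_peak i u x v (w := u ++ x :: v) (c := first_occ w + q) :
    first_peak i u x v ->
  [/\ first_occ w < size w, take c w = u, nth 0 w c = x & drop c.+1 w = v].
Proof.
move=> fp; rewrite /c /w (first_occ_peak fp); case: fp => szu _ _.
rewrite -szu take_size_cat // nth_peak size_cat /=; split=> //; first by lia.
by rewrite -cat_rcons drop_size_cat // size_rcons.
Qed.

Lemma raise_peaksE n k i u x v : first_peak i u x v ->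
  raise_peaks n.+1 k (u ++ x :: v) =
  u ++ (k + shoulder u v - x)
    :: map (expand (shoulder u v) (k - x.+1)) (raise_peaks n x.+1 v).
Proof. by move=> fp /=; have [-> -> -> ->] := split_peak fp. Qed.

Lemma lower_peaksE n k i u x' v (x := k + shoulder u v - x') :
    first_peak i u x' v ->
  lower_peaks n.+1 k (u ++ x' :: v) =
  u ++ x :: lower_peaks n x.+1 (map (contract (shoulder u v) (k - x.+1)) v).
Proof. by move=> fp /=; have [-> -> -> ->] := split_peak fp. Qed.

(** The words agree on every prefix containing no peak of [w]. Taking [N = l - q.+1] on the tail
    keeps the window of the previous peak intact, and [N = 1] keeps the first letter. *)
Definition same_start (w w' : seq nat) : Prop :=
  forall N, (forall i, occurs_at w i -> N <= i + q) -> take N w' = take N w.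

Lemma same_start_peak i u x v x' v' : first_peak i u x v ->
  same_start (u ++ x :: v) (u ++ x' :: v').
Proof.
case=> szu occ _ N /(_ _ occ); rewrite -szu => leN.
by rewrite !takel_cat.
Qed.

Lemma no_occ_avoids w : (forall i, ~~ occurs_at w i) ->
  avoids_above w /\ avoids_between w.
Proof. by move=> no; split=> i z /(negP (no i)). Qed.

Lemma no_occ_nil : avoids_above [::] /\ avoids_between [::].
Proof.
by apply: no_occ_avoids => i; apply/negP => /occurs_atP[]; rewrite /=; lia.
Qed.

(** Induction along the peaks. Avoidance bounds [v] by [x], so the induction hypothesis applies to
    [v] over an alphabet of size [x.+1]. Its invariant [same_start] ensures that the new word has
    its first peak at the same place with the same shoulder. *)
Lemma raise_peaksP n k w :
    size w <= n -> all (gtn k) w -> avoids_above w ->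
  let w' := raise_peaks n k w in
  [/\ size w' = size w, all (gtn k) w', avoids_between w',
      same_start w w' & lower_peaks n k w' = w].
Proof.
elim: n k w => [|n IHn] k w szw wk av; lazy zeta.
  case: w szw {wk av} => //= _; split=> //; by case: no_occ_nil.
case: (first_occP w) szw wk av => [no eqsz _ wk _|i u x v fp].
  rewrite /= eqsz ltnn; split=> //; first by case: (no_occ_avoids no).
  by rewrite eqsz ltnn.
rewrite size_cat all_cat [size (_ :: _)]/= [all _ (_ :: _)]/= => szw /and3P[uk xk vk].
case/(avoids_above_peak fp)=> vx av.
rewrite (raise_peaksE _ _ fp); set m := shoulder u v; set d := k - x.+1.
have [szv' v'x av' start v'K] := IHn x.+1 v ltac:(lia) vx av.
have ltmx : m < x := first_peak_lt fp.
set v' := raise_peaks n x.+1 v in szv' v'x av' start v'K *.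
(* No peak of [v] lies among these letters, so the recursive call fixes them. They are at most [m],
   so [expand] fixes them too. *)
have tk : take (l - q.+1) (map (expand m d) v') = take (l - q.+1) v.
  rewrite -map_take start; last exact: (first_peak_tail_occ fp).
  rewrite -[RHS]map_id; apply/eq_in_map => y /(first_peak_tail fp).
  by rewrite -/m /expand => ->.
have [fp' shE] := @first_peak_change _ _ _ _ fp (k + m - x) _ ltac:(lia) tk.
split.
- by rewrite !size_cat /= size_map szv'.
- rewrite all_cat uk /= all_map; apply/andP; split; first by lia.
  apply: sub_all v'x => y /=; rewrite /expand /d; case: ifP; lia.
- apply/(avoids_between_peak fp'); split; last by apply/avoids_between_map/av'/expand_mono.
  (* A letter above [m] becomes at least [m + 1 + d], which is the new peak [k + m - x]. *)
  rewrite all_map; apply/allP => y _ /=; apply/implyP; rewrite shE -/m /expand.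
  by rewrite /d; case: (leqP y m); lia.
- exact: same_start_peak fp.
rewrite (lower_peaksE _ _ fp') shE -/m.
have -> : k + m - (k + m - x) = x by lia.
by rewrite mapK ?v'K //; apply: expandK.
Qed.

Lemma lower_peaksP n k w :
    size w <= n -> all (gtn k) w -> avoids_between w ->
  let w' := lower_peaks n k w in
  [/\ size w' = size w, all (gtn k) w', avoids_above w',
      same_start w w' & raise_peaks n k w' = w].
Proof.
elim: n k w => [|n IHn] k w szw wk av; lazy zeta.
  case: w szw {wk av} => //= _; split=> //; by case: no_occ_nil.
case: (first_occP w) szw wk av => [no eqsz _ wk _|i u x' v fp].
  rewrite /= eqsz ltnn; split=> //; first by case: (no_occ_avoids no).
  by rewrite eqsz ltnn.
rewrite size_cat all_cat [size (_ :: _)]/= [all _ (_ :: _)]/= => szw /and3P[uk x'k vk].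
case/(avoids_between_peak fp)=> vx av.
rewrite (lower_peaksE _ _ fp); set m := shoulder u v.
have ltmx : m < x' := first_peak_lt fp.
set x := k + m - x'; set d := k - x.+1; set v0 := map _ v.
(* Here [d = x' - m - 1], so the gap to be closed consists of the values strictly between [m] and
   [x'], which [v] avoids. *)
have vE : map (expand m d) v0 = v.
  rewrite -map_comp -[RHS]map_id; apply/eq_in_map => y yv /=.
  apply: contractK; apply/implyP => ltmy; have /implyP := allP vx y yv.
  by move/(_ ltmy); rewrite /d /x; lia.
have av0 : avoids_between v0.
  by apply/(avoids_between_map _ (@expand_mono m d)); rewrite vE.
have v0x : all (gtn x.+1) v0.
  rewrite all_map; apply: sub_all vk => y /=; rewrite /contract.
  by case: ifP; rewrite /d /x; lia.
have [szv' v'x av' start v'K] := IHn x.+1 v0 ltac:(rewrite size_map; lia) v0x av0.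
set v' := lower_peaks n x.+1 v0 in szv' v'x av' start v'K *.
have tk : take (l - q.+1) v' = take (l - q.+1) v.
  rewrite start => [|i' occ]; last first.
    (* As [expand] preserves order, [v0] and [v] have the same occurrences. *)
    by apply: (first_peak_tail_occ fp); rewrite -vE occurs_at_map //; apply: expand_mono.
  rewrite -map_take -[RHS]map_id; apply/eq_in_map => y /(first_peak_tail fp).
  by rewrite -/m /contract => ->.
have [fp' shE] := @first_peak_change _ _ _ _ fp x _ ltac:(lia) tk.
split.
- by rewrite !size_cat /= szv' size_map.
- rewrite all_cat uk /=; apply/andP; split; first by lia.
  by apply: sub_all v'x => y /=; lia.
- by apply/(avoids_above_peak fp').
- exact: same_start_peak fp.
rewrite (raise_peaksE _ _ fp') shE -/m v'K vE.
by congr (_ ++ _ :: _); lia.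
Qed.

End ConsecutivePeak.

(** * Order isomorphism and containment in terms of letter comparisons *)

Lemma size_undup_map (T1 T2 : eqType) (f : T1 -> T2) (s : seq T1) :
  {in s &, injective f} -> size (undup (map f s)) = size (undup s).
Proof.
move=> f_inj; rewrite -(size_map f (undup s)).
apply/perm_size/uniq_perm; first exact: undup_uniq.
  by rewrite map_inj_in_uniq ?undup_uniq // => y z; rewrite !mem_undup; apply: f_inj.
by move=> y; rewrite mem_undup; apply: eq_mem_map => z; rewrite mem_undup.
Qed.

Lemma standardize_mono s :
  {in s &, {mono (fun x => size (undup [seq y <- s | y <= x])) : x y / x <= y}}.
Proof.
have mem x y : (y \in undup [seq z <- s | z <= x]) = (y <= x) && (y \in s).
  by rewrite mem_undup mem_filter.
move=> x y xs ys; apply/idP/idP; last first.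
  move=> lexy; apply: uniq_leq_size (undup_uniq _) _ => z.
  by rewrite !mem => /andP[/leq_trans-> //].
apply: contraTT; rewrite -!ltnNge => ltyx.
(* The inequality of ranks is strict because [x] itself is counted in its own rank but not in that
   of the smaller [y]. *)
apply: (@uniq_leq_size _ (x :: _)) => [|z].
  by rewrite /= undup_uniq mem leqNgt ltyx.
rewrite inE !mem => /predU1P[->|/andP[lezy ->]]; first by rewrite leqnn.
by rewrite (leq_trans lezy (ltnW ltyx)).
Qed.

Lemma order_isomorphicP s t :
  reflect (size s = size t /\ forall a b, a < size s -> b < size s ->
             (nth 0 s a <= nth 0 s b) = (nth 0 t a <= nth 0 t b))
          (order_isomorphic s t).
Proof.
apply: (iffP eqP) => [eqst|[eqsz eqle]].
  have eqsz : size s = size t by have := congr1 size eqst; rewrite !size_map.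
  have eqr c : c < size s ->
      size (undup [seq y <- s | y <= nth 0 s c]) =
      size (undup [seq y <- t | y <= nth 0 t c]).
    move=> lts; have := congr1 (nth 0 ^~ c) eqst.
    by rewrite /standardize !(nth_map 0) -?eqsz.
  split=> // a b ltas ltbs.
  rewrite -(@standardize_mono s) ?mem_nth // !eqr //.
  by rewrite standardize_mono ?mem_nth // -eqsz.
(* Each letter of [s] is sent to the letter of [t] at the same position. Equal letters of [s] face
   equal letters of [t], so the choice of position is immaterial; [f] preserves order on [s], hence
   ranks. *)
pose f x := nth 0 t (index x s).
have eqf a : a < size s -> f (nth 0 s a) = nth 0 t a.
  move=> ltas; have lti : index (nth 0 s a) s < size s by rewrite index_mem mem_nth.
  by apply/eqP; rewrite eqn_leq -!eqle ?nth_index ?mem_nth ?leqnn.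
have -> : t = map f s.
  apply: (@eq_from_nth _ 0) => [|a]; rewrite ?size_map // -eqsz => lta.
  by rewrite (nth_map 0) // eqf.
have fmono : {in s &, {mono f : x y / x <= y}}.
  move=> x y xs ys; rewrite /f -eqle ?index_mem // !nth_index //.
rewrite /standardize -map_comp; apply/eq_in_map => x xs /=.
rewrite filter_map size_undup_map.
  by congr (size (undup _)); apply/eq_in_filter => y ys /=; rewrite fmono.
move=> y z; rewrite !mem_filter => /andP[_ ys] /andP[_ zs] eqyz.
by apply/eqP; rewrite eqn_leq -(fmono y z) // -(fmono z y) // eqyz leqnn.
Qed.

Lemma containsP (sigma : vincular) (n k : nat) (w : n.-tuple 'I_k) :
  reflect (exists pos : seq nat,
    [/\ size pos = size (vword sigma), all (gtn n) pos, sorted ltn pos,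
        order_isomorphic [seq nth 0 (map val w) p | p <- pos] (vword sigma) &
        all (fun r => (r \in vdashes sigma)
                      || (letter pos r.+1 == (letter pos r).+1))
            (iota 1 (size (vword sigma)).-1)])
  (contains sigma w).
Proof.
have lettersE (idx : seq 'I_n) :
    [seq nth 0 (map val w) p | p <- map val idx] = [seq val (tnth w i) | i <- idx].
  rewrite -map_comp; apply: eq_map => i /=.
  by rewrite (nth_map (tnth w i)) ?size_tuple // -tnth_nth.
apply: (iffP existsP) => [[idx /and3P[srt iso adj]]|[pos [szp ltp srt iso adj]]].
  exists (map val idx); split=> //; first by rewrite size_map size_tuple.
    by apply/allP => _ /mapP[i _ ->] /=.
  by rewrite lettersE.
pose idx : seq 'I_n := pmap insub pos.
have idxE : map val idx = pos.
  rewrite (pmap_filter (insubK _)); apply/all_filterP.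
  by apply: sub_all ltp => p /= ltpn; rewrite isSome_insub.
have szidx : size idx == size (vword sigma) by rewrite -szp -idxE size_map.
exists (Tuple szidx); apply/and3P; split; rewrite /= ?idxE //.
by rewrite -lettersE idxE.
Qed.

(** With the only dash after the [l]-th letter, an occurrence is a window at [i] plus one later
    position [z]. Both directions of comparison with [z] are recorded so that ties are captured. *)
Lemma contains_last_dashP (t : seq nat) (l n k : nat) (w : n.-tuple 'I_k)
    (W := map val w) : 0 < l -> size t = l.+1 ->
  reflect (exists i z, [/\ i + l <= z < n, occurs_at t l W i &
             forall a, a < l ->
               (nth 0 W (i + a) <= nth 0 W z) = (nth 0 t a <= nth 0 t l) /\
               (nth 0 W z <= nth 0 W (i + a)) = (nth 0 t l <= nth 0 t a)])
          (contains (Vincular t [:: l]) w).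
Proof.
move=> l_gt0 szt; have szW : size W = n by rewrite size_map size_tuple.
apply: (iffP (containsP _ _)) => /= [[pos []]|[i [z [/andP[lez ltz] occ cmp]]]].
  rewrite szt /= => szp ltp srt /order_isomorphicP[_ iso] adj.
  (* None of the first [l - 1] gaps carries a dash, so each forces consecutive positions. *)
  have posE a : a < l -> nth 0 pos a = nth 0 pos 0 + a.
    elim: a => [|a IHa] lta; first by rewrite addn0.
    have /(allP adj): a.+1 \in iota 1 l by rewrite mem_iota; lia.
    rewrite inE /letter /= IHa; last by lia.
    by case/orP=> /eqP; lia.
  have isoE a b : a < l.+1 -> b < l.+1 ->
      (nth 0 W (nth 0 pos a) <= nth 0 W (nth 0 pos b)) = (nth 0 t a <= nth 0 t b).
    by move=> lta ltb; rewrite -iso ?size_map ?szp // !(nth_map 0) ?szp.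
  have ltn_last : nth 0 pos l.-1 < nth 0 pos l.
    by apply: (sorted_ltn_nth ltn_trans) => //; rewrite ?inE ?szp; lia.
  have lt_last : nth 0 pos l < n by apply: (allP ltp); rewrite mem_nth ?szp.
  rewrite posE in ltn_last; last by lia.
  exists (nth 0 pos 0), (nth 0 pos l); split; first by lia.
    apply/occurs_atP; split=> [|a b al bl]; first by lia.
    by rewrite -!posE // isoE //; lia.
  by move=> a al; rewrite -!posE // !isoE //; lia.
have [szi iso] := occurs_atP _ _ _ _ occ.
exists (rcons (iota i l) z).
have nthE a : a < l -> nth 0 (rcons (iota i l) z) a = i + a.
  by move=> al; rewrite nth_rcons size_iota al nth_iota.
have nthl : nth 0 (rcons (iota i l) z) l = z.
  by rewrite nth_rcons size_iota ltnn eqxx.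
rewrite szt size_rcons size_iota; split=> //.
- rewrite all_rcons /= ltz; apply/allP => p; rewrite mem_iota /=; lia.
- apply/(sortedP 0) => a; rewrite size_rcons size_iota ltnS => al.
  rewrite nthE //; have [al'|] := ltnP a.+1 l; first by rewrite nthE //; lia.
  by move=> la; rewrite (_ : a.+1 = l) ?nthl; lia.
- apply/order_isomorphicP; rewrite size_map size_rcons size_iota szt; split=> // a b al bl.
  rewrite !(nth_map 0) ?size_rcons ?size_iota //; move: al bl.
  rewrite !ltnS (leq_eqVlt a) (leq_eqVlt b).
  case/predU1P=> [->|al]; case/predU1P=> [->|bl]; rewrite ?nthl ?nthE //.
  - by rewrite !leqnn.
  - by case: (cmp b bl).
  - by case: (cmp a al).
  exact: iso.
apply/allP => r; rewrite mem_iota inE /letter /= => ltr.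
have [->//|neq] := eqVneq r l; rewrite !nthE; lia.
Qed.

(** * The two patterns as conditions on peaks, and the equality of counts *)

Section PeakSwap.

Variables (t : seq nat) (q l : nat).

Hypothesis q_gt0 : 0 < q.
Hypothesis q_lt : q.+1 < l.
Hypothesis size_t : size t = l.+1.
Hypothesis t_up : forall a, a < q -> nth 0 t a <= nth 0 t a.+1.
Hypothesis t_down : forall a, q <= a -> a.+1 < l -> nth 0 t a.+1 <= nth 0 t a.
Hypothesis t_left : nth 0 t q.-1 < nth 0 t q.
Hypothesis t_right : nth 0 t q.+1 < nth 0 t q.
Hypothesis t_last : nth 0 t q < nth 0 t l.

Let t_lt_peak a : a < l -> a != q -> nth 0 t a < nth 0 t q.
Proof. exact: pattern_lt_peak. Qed.

Let t_le_left a : a < q -> nth 0 t a <= nth 0 t q.-1.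
Proof. exact: (pattern_le_left q_gt0 q_lt). Qed.

Let t_le_right a : q < a < l -> nth 0 t a <= nth 0 t q.+1.
Proof. exact: (pattern_le_right q_gt0 q_lt). Qed.

(** The last letter of [t] exceeds the peak, the maximum of the first [l] letters, so a later
    position completes an occurrence exactly when its letter exceeds the peak of the window. *)
Lemma avoids_aboveP (n k : nat) (w : n.-tuple 'I_k) :
  reflect (avoids_above t q l (map val w)) (avoids (Vincular t [:: l]) w).
Proof.
have szw : size (map val w) = n by rewrite size_map size_tuple.
set W := map val w in szw *; have l_gt0 : 0 < l by lia.
apply: (iffP negP) => [av i z occ|av /(contains_last_dashP _ l_gt0 size_t)].
  rewrite szw => /andP[ltz ltzn].
  have [lez|ltz'] := leqP (i + l) z; last first.
    have -> : z = i + (z - i) by lia.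
    by apply: occurs_at_le occ _ _ (ltnW (t_lt_peak _ _)); lia.
  rewrite leqNgt; apply/negP => lt; apply: av.
  apply/(contains_last_dashP _ l_gt0 size_t); exists i, z; split=> //; first by lia.
  move=> a al; have le_t : nth 0 t a <= nth 0 t q.
    by have [->//|aq] := eqVneq a q; rewrite ltnW ?t_lt_peak.
  by have := occurs_at_le occ al (ltnW q_lt : q < l) le_t; rewrite -/W; lia.
move=> [i [z [lez occ cmp]]]; have := av i z occ; rewrite szw -/W.
have [_] := cmp q (ltnW q_lt); rewrite -/W; lia.
Qed.

Let t' : seq nat := swap_letters t q.+1 (l + 1).

Lemma size_swap : size t' = l.+1.
Proof. by rewrite /t' /swap_letters !size_set_nth size_t; lia. Qed.

Lemma nth_swap a :
  nth 0 t' a = if a == l then nth 0 t q else if a == q then nth 0 t l else nth 0 t a.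
Proof. by rewrite /t' /swap_letters addn1 nth_set_nth /= nth_set_nth. Qed.

(** The swap replaces the strict maximum of the first [l] letters by an even larger one. *)
Lemma occurs_at_swap W i : occurs_at t' l W i = occurs_at t l W i.
Proof.
have eqt a b : a < l -> b < l ->
    (nth 0 t' a <= nth 0 t' b) = (nth 0 t a <= nth 0 t b).
  move=> al bl; rewrite !nth_swap (ltn_eqF al) (ltn_eqF bl).
  have [->|aq] := eqVneq a q; have [->|bq] := eqVneq b q; rewrite ?leqnn //.
    by have := t_lt_peak bl bq; lia.
  by have := t_lt_peak al aq; lia.
by apply/occurs_atP/occurs_atP => -[szW occ]; split=> // a b al bl;
  rewrite occ ?eqt.
Qed.

(** After the swap the last letter lies below the peak and above all other letters, so an occurrence
    is completed exactly by a later letter strictly between the shoulder and the peak. *)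
Lemma avoids_betweenP (n k : nat) (w : n.-tuple 'I_k) :
  reflect (avoids_between t q l (map val w)) (avoids (Vincular t' [:: l]) w).
Proof.
have szw : size (map val w) = n by rewrite size_map size_tuple.
set W := map val w in szw *; have l_gt0 : 0 < l by lia.
apply: (iffP negP) => [av i z occ|av /(contains_last_dashP _ l_gt0 size_swap)].
  rewrite szw gtn_max => /andP[ltz ltzn] /andP[lt_l lt_r].
  have lt_a a : a < l -> a != q -> nth 0 W (i + a) < nth 0 W z.
    move=> al aq; have [aq'|qa|] := ltngtP a q; last by lia.
      apply: leq_ltn_trans lt_l; have -> : (i + q).-1 = i + q.-1 by lia.
      by apply: occurs_at_le occ _ _ (t_le_left aq'); lia.
    apply: leq_ltn_trans lt_r; have -> : (i + q).+1 = i + q.+1 by lia.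
    by apply: occurs_at_le occ _ _ (t_le_right _); lia.
  have [lez|ltz'] := leqP (i + l) z; last first.
    (* A position [z] inside the window would have a letter smaller than itself. *)
    have := lt_a (z - i); rewrite subnKC; lia.
  rewrite leqNgt; apply/negP => lt; apply: av.
  apply/(contains_last_dashP _ l_gt0 size_swap); exists i, z.
  rewrite occurs_at_swap -/W; split=> //; first by lia.
  move=> a al; rewrite !nth_swap eqxx (ltn_eqF al).
  have [->|aq] := eqVneq a q; first by lia.
  by have := lt_a a al aq; have := t_lt_peak al aq; lia.
move=> [i [z [lez]]]; rewrite occurs_at_swap -/W => occ cmp.
have cmpE a : a < l -> (nth 0 W z <= nth 0 W (i + a)) = (a == q).
  move=> al; have [_ ->] := cmp a al; rewrite !nth_swap eqxx (ltn_eqF al).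
  have [_|aq] := eqVneq a q; first by lia.
  by have := t_lt_peak al aq; lia.
have cmpq : (nth 0 W (i + q) <= nth 0 W z) = false.
  have [-> _] := cmp q (ltnW q_lt); rewrite !nth_swap !eqxx (ltn_eqF (ltnW q_lt)); lia.
have := av i z occ; rewrite szw -/W cmpq gtn_max.
have -> : (i + q).-1 = i + q.-1 by lia.
have -> : (i + q).+1 = i + q.+1 by lia.
by rewrite !ltnNge !cmpE; lia.
Qed.

(** The predicate [C] on the first letter serves both claims at once: [predT] gives the total counts
    and [pred1 (Some a)] the refined ones. *)
Lemma card_avoids_swap (n k : nat) (C : pred (option 'I_k)) : 0 < k ->
  #|[set w : n.-tuple 'I_k | avoids (Vincular t [:: l]) w & C (ohead w)]| =
  #|[set w : n.-tuple 'I_k | avoids (Vincular t' [:: l]) w & C (ohead w)]|.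
Proof.
case: k C => // k C _.
pose word (v : seq nat) : n.-tuple 'I_k.+1 := [tuple inord (nth 0 v i) | i < n].
have wordK v : size v = n -> all (gtn k.+1) v -> map val (word v) = v.
  move=> szv /allP ltv; apply: (@eq_from_nth _ 0); first by rewrite size_map size_tuple.
  move=> a; rewrite size_map size_tuple => an.
  rewrite (nth_map ord0) ?size_tuple // -(tnth_nth _ _ (Ordinal an)) tnth_mktuple.
  by rewrite /= inordK //; apply: ltv; rewrite mem_nth ?szv.
have valI (w1 w2 : n.-tuple 'I_k.+1) : map val w1 = map val w2 -> w1 = w2.
  by move/(inj_map val_inj)/val_inj.
have ltw (w : n.-tuple 'I_k.+1) : all (gtn k.+1) (map val w).
  by apply/allP => _ /mapP[x _ ->] /=.
have szw (w : n.-tuple 'I_k.+1) : size (map val w) = n.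
  by rewrite size_map size_tuple.
have startE (w1 w2 : n.-tuple 'I_k.+1) :
    same_start t q l (map val w1) (map val w2) -> ohead w2 = ohead w1.
  (* The prefix length 1 is allowed because every peak has position [i + q] with [0 < q]. *)
  move=> /(_ 1) start; have {start} : take 1 (map val w2) = take 1 (map val w1).
    by apply: start => i _; lia.
  rewrite -!map_take => /(inj_map val_inj).
  by case: (val w1) => [|x1 s1]; case: (val w2) => [|x2 s2] //=; rewrite !take0 => -[->].
pose f (w : n.-tuple 'I_k.+1) := word (raise_peaks t q l n k.+1 (map val w)).
pose g (w : n.-tuple 'I_k.+1) := word (lower_peaks t q l n k.+1 (map val w)).
have fP w : avoids (Vincular t [:: l]) w ->
    [/\ avoids (Vincular t' [:: l]) (f w), ohead (f w) = ohead w & g (f w) = w].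
  move/avoids_aboveP => av.
  have [|sz lt av' start fK] := raise_peaksP q_gt0 q_lt t_up t_down t_left t_right
    (n := n) _ (ltw w) av; first by rewrite szw.
  rewrite szw in sz; have fE := wordK _ sz lt.
  split; first by apply/avoids_betweenP; rewrite fE.
    by apply: startE; rewrite fE.
  by apply: valI; rewrite /g fE fK wordK.
have gP w : avoids (Vincular t' [:: l]) w ->
    [/\ avoids (Vincular t [:: l]) (g w), ohead (g w) = ohead w & f (g w) = w].
  move/avoids_betweenP => av.
  have [|sz lt av' start gK] := lower_peaksP q_gt0 q_lt t_up t_down t_left t_right
    (n := n) _ (ltw w) av; first by rewrite szw.
  rewrite szw in sz; have gE := wordK _ sz lt.
  split; first by apply/avoids_aboveP; rewrite gE.
    by apply: startE; rewrite gE.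
  by apply: valI; rewrite /f gE gK wordK.
apply/eqP; rewrite eqn_leq; apply/andP; split.
  rewrite -(@card_in_imset _ _ f); last first.
    move=> w1 w2; rewrite !inE => /andP[/fP[_ _ K1] _] /andP[/fP[_ _ K2] _] eqf.
    by rewrite -K1 eqf K2.
  apply/subset_leq_card/subsetP => _ /imsetP[w + ->]; rewrite !inE.
  by case/andP=> /fP[-> -> _].
rewrite -(@card_in_imset _ _ g); last first.
  move=> w1 w2; rewrite !inE => /andP[/gP[_ _ K1] _] /andP[/gP[_ _ K2] _] eqg.
  by rewrite -K1 eqg K2.
apply/subset_leq_card/subsetP => _ /imsetP[w + ->]; rewrite !inE.
by case/andP=> /gP[-> -> _].
Qed.

End PeakSwap.

Theorem theorem2p2 (l j : nat) (t : seq nat)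
  (hl : 3 <= l)
  (ht : is_pattern t)
  (hsize : size t = l.+1)
  (hj : 2 <= j <= l - 1)
  (hincr : forall i : nat, 1 <= i -> i + 1 <= j - 1 ->
     letter t i <= letter t (i + 1))
  (hleft : letter t (j - 1) < letter t j)
  (hright : letter t j > letter t (j + 1))
  (hdecr : forall i : nat, j + 1 <= i -> i + 1 <= l ->
     letter t i >= letter t (i + 1))
  (hlast : letter t j < letter t (l + 1)) :
  let tau := Vincular t [:: l] in
  let rho := Vincular (swap_letters t j (l + 1)) [:: l] in
  wilf_equivalent tau rho /\
  (forall (n k : nat) (a : 'I_k), 1 <= n -> 1 <= k ->
     num_avoid_first tau n a = num_avoid_first rho n a).
Proof.
(* The peak position [j = q.+1] counted from 1 is the index [q] counted from 0. *)
case: j hj hincr hleft hright hdecr hlast => [|q] // hj hincr hleft hright hdecr hlast.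
have letterE a : nth 0 t a = letter t (a + 1) by rewrite addn1.
have q_gt0 : 0 < q by lia.
have q_lt : q.+1 < l by lia.
have t_left : nth 0 t q.-1 < nth 0 t q.
  by rewrite !letterE; move: hleft; rewrite subn1 !addn1 prednK.
have t_right : nth 0 t q.+1 < nth 0 t q by rewrite letterE; exact: hright.
have t_up a : a < q -> nth 0 t a <= nth 0 t a.+1.
  (* [hincr] stops at the letter before the peak; the last ascent comes from the strict inequality
     [t_left]. *)
  move=> aq; have [eqa|neqa] := eqVneq a q.-1; first by rewrite eqa prednK // ltnW.
  by rewrite !letterE -(addn1 a); apply: hincr; lia.
have t_down a : q <= a -> a.+1 < l -> nth 0 t a.+1 <= nth 0 t a.
  rewrite leq_eqVlt => /predU1P[<- _|qa al]; first exact: ltnW.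
  by rewrite !letterE -(addn1 a); apply: hdecr; lia.
have t_last : nth 0 t q < nth 0 t l by rewrite (letterE l).
have card n k C := @card_avoids_swap t q l q_gt0 q_lt hsize t_up t_down t_left
  t_right t_last n k C.
split=> [n k k_gt0|n k a _ k_gt0]; last exact: (card n k (pred1 (Some a))).
have := card n k predT k_gt0; rewrite /num_avoid.
by under eq_finset do rewrite andbT; under [in RHS]eq_finset do rewrite andbT.
Qed.
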